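(* There exist an absolute constant $c>0$ and a $p_0$ such that for every prime $p\geq p_0$ the following holds. There are $n_0=n_0(p)$ and sets $A_n\subseteq\mathbb F_p^n$, one for each $n\geq n_0$, with density $|A_n|/p^n=\frac12+o_n(1)$ (i.e. for fixed $p$, $|A_n|/p^n\to\frac12$ as $n\to\infty$), such that for every $n\ge n_0$ \[ \max_{d\in\mathbb F_p^n\setminus\{0\}}\min\bigl\{I_3(1_{A_n})(d),\,I_3(1_{A_n})(2d)\bigr\}\leq\frac18-c. \]
   Context: For a finite set $X$, $\mathbb E_{x\in X}f(x):=\frac1{|X|}\sum_{x\in X}f(x)$. For $f:\mathbb F_p^n\to\mathbb R$ and $d\in\mathbb F_p^n\setminus\{0\}$, \[ I_3(f)(d):=\mathbb E_{x\in\mathbb F_p^n}f(x)f(x+d)f(x+2d). \] $1_A$ is the indicator function of $A$. *)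

(* Defs.v *)
From HB Require Import structures.
From mathcomp Require Import all_boot all_order all_algebra.
From mathcomp Require Import all_classical all_reals all_analysis.
Set Implicit Arguments. Unset Strict Implicit. Unset Printing Implicit Defensive.
Import Order.TTheory GRing.Theory Num.Theory.
Import numFieldNormedType.Exports.
Local Open Scope ring_scope.

Definition expect (R : realType) (X : finType) (f : X -> R) : R :=
  #|X|%:R^-1 * \sum_(x : X) f x.

Definition ind (R : realType) (X : finType) (A : {set X}) (x : X) : R :=
  (x \in A)%:R.

(* 'F_p is the field with p elements only when p is prime. *)
Definition I3 (R : realType) (p n : nat) (f : 'rV['F_p]_n -> R)
    (d : 'rV['F_p]_n) : R :=
  expect (fun x => f x * f (x + d) * f (x + d *+ 2)).

Definition density (R : realType) (p n : nat) (A : {set 'rV['F_p]_n}) : R :=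
  #|A|%:R / (p ^ n)%:R.

(* Main.v *)
Require Import Defs.
From HB Require Import structures.
From mathcomp Require Import all_boot all_order all_algebra.
From mathcomp Require Import all_classical all_reals all_analysis.
From mathcomp Require Import all_field complex ring lra zify.
Import Order.TTheory GRing.Theory Num.Theory.
Import numFieldNormedType.Exports.
Set Implicit Arguments. Unset Strict Implicit. Unset Printing Implicit Defensive.
Local Open Scope ring_scope.

(** Fix a profile f : F_p -> [0,1] of mean 1/2, identify F_p^n with the field
    K of size p^n, and let tau : K -> F_p be additive and nonzero. Put x in A
    when the residue tau (x^5), which acts as an independent uniform random
    variable, is smaller than p f(tau (x^2)). For d <> 0, Weyl differencing
    shows that tau (x^2), tau ((x+d)^2), tau (x^5), tau ((x+d)^5),
    tau ((x+2d)^5) are jointly equidistributed as n grows, while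
    tau ((x+2d)^2) = 2 tau ((x+d)^2) - tau (x^2) + s with s = 2 tau (d^2).
    Hence I_3(1_A)(d) is close to T(s) = E_{a,b} f(a) f(b) f(2b-a+s), and
    replacing d by 2d replaces s by 4s. For the trigonometric polynomial
    f = 1/2 + (3 c_1 + c_2 + 2 c_3 + 3 c_4 + 3 c_5 - 3 c_6 - 2 c_8 - c_10) / 36,
    c_k(a) = cos (2 pi k a / p), Fourier inversion gives
    T(s) = 1/8 - (3/4) 36^(-3) (-3 c_1 - c_2 + 4 c_3 + 6 c_4 + 3 c_5)(s),
    and the last bracket is bounded below by 3/8 at s or at 4s for every s.
    Finally A is changed on a set of density O(1/p) to get density 1/2. *)

(** * Weyl sums over finite fields *)

Lemma eq_ler (R : numDomainType) (x y : R) : x = y -> x <= y.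
Proof. by move->. Qed.

Section UnitCharacters.
Variables (C : numClosedFieldType) (G : finZmodType) (psi : G -> C).
Hypothesis psiD : forall x y, psi (x + y) = psi x * psi y.
Hypothesis psi_norm : forall x, `|psi x| = 1.

(** Translating the variable by [x0] multiplies the sum by [psi x0]. *)
Lemma sum_character_eq0 (x0 : G) : psi x0 != 1 -> \sum_x psi x = 0.
Proof.
move=> h; have /eqP : \sum_x psi x = psi x0 * \sum_x psi x.
  rewrite mulr_sumr (reindex_inj (addrI x0)) /=.
  by apply: eq_bigr => x _; rewrite psiD.
rewrite -subr_eq0 -{1}(mul1r (\sum_x _)) -mulrBl mulf_eq0 subr_eq0 eq_sym.
by rewrite (negPf h) /= => /eqP.
Qed.

Lemma character0 : psi 0 = 1.
Proof.
have h : psi 0 != 0 by rewrite -normr_eq0 psi_norm oner_eq0.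
by apply: (mulfI h); rewrite -psiD addr0 mulr1.
Qed.

Lemma character_conj x : (psi x)^* = psi (- x).
Proof.
have h : psi x != 0 by rewrite -normr_eq0 psi_norm oner_eq0.
by apply: (mulfI h); rewrite -psiD subrr character0 -normCK psi_norm expr1n.
Qed.

(** The square is a sum over pairs of points; group the pairs by their difference [h] and apply the
    triangle inequality over [h]. *)
Lemma weyl_differencing (f : G -> G) :
  `|\sum_x psi (f x)| ^+ 2 <= \sum_h `|\sum_x psi (f (x + h) - f x)|.
Proof.
have eqS : `|\sum_x psi (f x)| ^+ 2
          = \sum_h \sum_x psi (f (x + h) - f x).
  rewrite normCK rmorph_sum mulr_sumr [RHS]exchange_big /=.
  apply: eq_bigr => x _; rewrite mulr_suml (reindex_inj (addrI x)) /=.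
  by apply: eq_bigr => h _; rewrite psiD character_conj.
by rewrite -[leLHS]ger0_norm ?exprn_ge0 // eqS ler_norm_sum.
Qed.
End UnitCharacters.

(* The difference of a polynomial function of degree k+2 along h <> 0 is a
   polynomial function of degree k+1, so Weyl differencing gives
   |S|^2 <= |K| + |K| max_h |S_h|. *)
Lemma weyl_bound (C : numClosedFieldType) (k m : nat) :
  exists N : nat, forall (K : finFieldType) (psi : K -> C),
    (forall x y, psi (x + y) = psi x * psi y) -> (forall x, `|psi x| = 1) ->
    (exists x, psi x != 1) ->
    (forall i, (0 < i <= k.+1)%N -> (i%:R : K) != 0) -> (N <= #|K|)%N ->
    forall c : nat -> K, c k.+1 != 0 ->
    m%:R * `|\sum_x psi (\sum_(i < k.+2) c i * x ^+ i)| <= #|K|%:R.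
Proof.
elim: k m => [|k IH] m.
  exists 0%N => K psi psiD psi1 [x0 hx0] _ _ c c1.
  under eq_bigr => x _ do rewrite !big_ord_recl big_ord0 /= expr0 expr1 mulr1 addr0 psiD.
  rewrite -mulr_sumr (@sum_character_eq0 C K (fun x => psi (c 1%N * x)) _ (x0 / c 1%N)).
  - by rewrite mulr0 normr0 mulr0.
  - by move=> x y; rewrite mulrDr psiD.
  - by rewrite mulrC divfK.
(* With [2 * m ^ 2] in the degree below, differencing gives [2 m^2 |S|^2 <= |K|^2 + 2 m^2 |K|],
   which is at most [2 |K|^2] once [|K| >= 2 m^2]. *)
have [N hN] := IH (2 * m ^ 2)%N.
exists (maxn N (2 * m ^ 2)) => K psi psiD psi1 nt char0.
rewrite geq_max => /andP[NK mK] c ck.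
pose f x := \sum_(i < k.+3) c i * x ^+ i.
(* Binomial expansion of the difference; [j < i] drops the terms cancelled by [f x]. *)
pose c' h j := \sum_(i < k.+3 | (j < i)%N) c i * h ^+ (i - j) *+ 'C(i, j).
have diff x h : f (x + h) - f x = \sum_(j < k.+2) c' h j * x ^+ j.
  rewrite /f -sumrB.
  under eq_bigr => i _.
    rewrite -mulrBr [x + h]addrC exprDn big_ord_recr /= subnn expr0 mul1r binn mulr1n addrK mulr_sumr.
    rewrite (big_ord_widen k.+2 (fun j => c i * (h ^+ (i - j) * x ^+ j *+ 'C(i, j)))) -1?ltnS //.
    over.
  rewrite (exchange_big_dep predT) //=; apply: eq_bigr => j _.
  rewrite /c' mulr_suml; apply: eq_bigr => i _.
  by rewrite !mulrnAr mulrnAl mulrA.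
(* The leading coefficient is [(k + 2) * c k.+2 * h]. *)
have lead h : h != 0 -> c' h k.+1 != 0.
  move=> h0; rewrite /c' (big_pred1 ord_max) /=.
    by rewrite subSnn binSn expr1 -mulr_natr !mulf_neq0 // char0 // leqnn.
  move=> i; rewrite -[RHS]/(i == ord_max) -val_eqE /=; have := ltn_ord i; lia.
have bound h : (2 * m ^ 2)%:R * `|\sum_x psi (f (x + h) - f x)|
    <= #|K|%:R + (if h == 0 then (2 * m ^ 2)%:R * #|K|%:R else 0).
  have [->|h0] := eqVneq h 0.
    rewrite ler_wpDl // ler_wpM2l //.
    apply: le_trans (ler_norm_sum _ _ _) _.
    by under eq_bigr do rewrite psi1; rewrite sumr_const.
  rewrite addr0; under eq_bigr => x _ do rewrite diff.
  apply: (hN K psi psiD psi1 nt _ NK (c' h)); last exact: lead.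
  by move=> i /andP[i0 ik]; rewrite char0 // i0 ltnW.
have W := weyl_differencing psiD psi1 f.
have sumb : (2 * m ^ 2)%:R * `|\sum_x psi (f x)| ^+ 2 <= #|K|%:R ^+ 2 + (2 * m ^ 2)%:R * #|K|%:R.
  apply: (le_trans (ler_wpM2l _ W)); rewrite // mulr_sumr.
  apply: (le_trans (ler_sum _ (fun h _ => bound h))).
  rewrite big_split /= sumr_const -big_mkcond big_pred1_eq.
  by rewrite -[_ *+ #|xpredT|]mulr_natr -expr2.
rewrite -(ler_pXn2r (n := 2)) ?nnegrE ?mulr_ge0 //.
rewrite -(ler_pM2l (x := 2%:R)) // exprMn mulrA -[m%:R ^+ 2]natrX -[2 * (m ^ 2)%:R]natrM.
apply: le_trans sumb _.
by rewrite [leRHS]mulr_natl mulr2n lerD2l [leRHS]expr2 ler_wpM2r // ler_nat.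
Qed.

(** * Equidistribution in F_p^m *)

(** Take a root of [1 + X + ... + X^(p-1)]; it is not 1, since the value at 1 is [p]. *)
Lemma nontrivial_root_of_unity (C : numClosedFieldType) (p : nat) :
  prime p -> exists w : C, w ^+ p = 1 /\ w != 1.
Proof.
move=> p_pr; have p1 := prime_gt1 p_pr.
pose P : {poly C} := \poly_(i < p) 1.
have sP : size P = p by rewrite size_poly_eq ?oner_eq0.
have [|x /rootP hx] := @closed_rootP C P _.
  by rewrite sP; apply/eqP; lia.
have sumx : \sum_(i < p) x ^+ i = 0.
  by move: hx; rewrite horner_poly; under eq_bigr do rewrite mul1r.
exists x; split; first by apply/eqP; rewrite -subr_eq0 subrX1 sumx mulr0.
have : p%:R != 0 :> C by rewrite pnatr_eq0; lia.
apply: contraNneq => x1; apply/eqP; rewrite -sumx x1.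
by under eq_bigr do rewrite expr1n; rewrite sumr_const card_ord.
Qed.

Definition expFp (C : numClosedFieldType) (w : C) (p : nat) (a : 'F_p) : C :=
  w ^+ a.

Section ExpFp.
Variables (C : numClosedFieldType) (p : nat) (w : C).
Hypotheses (p_pr : prime p) (wp : w ^+ p = 1) (w1 : w != 1).
Let e := @expFp C w p.

Lemma expFpD a b : e (a + b) = e a * e b.
Proof.
have wp' : w ^+ (Zp_trunc (pdiv p)).+2 = 1 by rewrite Fp_cast.
by rewrite /e /expFp -exprD /= (expr_mod _ wp').
Qed.

Lemma expFp_norm a : `|e a| = 1.
Proof.
have : `|w| ^+ p = 1 by rewrite -normrX wp normr1.
move=> /eqP; rewrite pexpr_eq1 ?prime_gt0 // => /eqP h.
by rewrite /e /expFp normrX h expr1n.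
Qed.

Lemma expFpMn a k : e (a *+ k) = e a ^+ k.
Proof.
elim: k => [|k IH]; first by rewrite mulr0n expr0 /e /expFp expr0.
by rewrite mulrS expFpD IH exprS.
Qed.

Lemma expFp_neq1 a : a != 0 -> e a != 1.
Proof.
move=> a0; apply/eqP => h.
have : e (a *+ (a^-1 : 'F_p)) = 1 by rewrite expFpMn h expr1n.
rewrite -mulr_natr natr_Zp divff // /e /expFp.
have -> : (1%R : 'F_p) = 1%N :> nat by rewrite /= Fp_cast // modn_small ?prime_gt1.
by rewrite expr1; apply/eqP.
Qed.

Lemma sum_expFp a : \sum_x e (a * x) = if a == 0 then p%:R else 0.
Proof.
have [->|a0] := eqVneq a 0.
  under eq_bigr do rewrite mul0r /e /expFp expr0.
  by rewrite sumr_const card_Fp.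
apply: (@sum_character_eq0 _ _ (fun x => e (a * x)) _ 1).
  by move=> x y; rewrite mulrDr expFpD.
by rewrite mulr1 expFp_neq1.
Qed.

Lemma sum_expFp_row m (t : 'rV['F_p]_m) :
  \sum_(x : 'rV['F_p]_m) e ((x *m t^T) 0 0) = if t == 0 then (p ^ m)%:R else 0.
Proof.
have [->|t0] := eqVneq t 0.
  under eq_bigr do rewrite trmx0 mulmx0 mxE /e /expFp expr0.
  by rewrite sumr_const card_mx card_Fp // mul1n.
have [j tj] : exists j, t 0 j != 0.
  apply/existsP; apply: contraNT t0; rewrite negb_exists => /forallP h.
  by apply/eqP/rowP => j; rewrite mxE; apply/eqP; rewrite -[_ == _]negbK.
apply: (@sum_character_eq0 _ _ (fun x => e ((x *m t^T) 0 0)) _ (delta_mx 0 j)).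
  by move=> x y; rewrite mulmxDl mxE expFpD.
by rewrite -rowE !mxE expFp_neq1.
Qed.

(** Fourier inversion: [p ^ m] times the size of a fibre of [u] is a sum over frequencies [xi], in
    which [xi = 0] contributes [#|T|] and every other one at most [#|T| / M]. The outcome is a
    relative error [p ^ m / M], stated in [nat] with denominators cleared. *)
Lemma equidistribution (T : finType) (m M : nat) (u : T -> 'rV['F_p]_m) :
  (forall xi : 'rV['F_p]_m, xi != 0 ->
    M%:R * `|\sum_x e ((xi *m (u x)^T) 0 0)| <= #|T|%:R) ->
  forall E : {set 'rV['F_p]_m},
    (M * (#|[set x | u x \in E]| * p ^ m) <= (M + p ^ m) * (#|T| * #|E|))%N /\
    (M * (#|T| * #|E|) <= M * (#|[set x | u x \in E]| * p ^ m) + p ^ m * (#|T| * #|E|))%N.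
Proof.
move=> h.
have pt v : M%:R * `|(#|[set x | u x == v]| * p ^ m)%:R - #|T|%:R| <= (p ^ m * #|T|)%:R :> C.
  have -> : (#|[set x | u x == v]| * p ^ m)%:R =
    \sum_(xi : 'rV['F_p]_m) e (- (xi *m v^T) 0 0) * \sum_x e ((xi *m (u x)^T) 0 0).
    under eq_bigr => xi _ do rewrite mulr_sumr.
    rewrite exchange_big /=.
    transitivity (\sum_x if u x == v then (p ^ m)%:R else 0 : C).
      rewrite -big_mkcond sumr_const /= natrM mulrC -[RHS]mulr_natr; congr (_ * _%:R).
      by apply: eq_card => x; rewrite inE.
    apply: eq_bigr => x _; rewrite -subr_eq0 -sum_expFp_row.
    apply: eq_bigr => xi _.
    by rewrite -expFpD linearB mulmxBr /= !mxE addrC.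
  rewrite (bigD1 0) //= mul0mx mxE oppr0.
  have e0 : e 0 = 1 by rewrite /e /expFp expr0.
  have -> : \sum_x e (((0 : 'rV_m) *m (u x)^T) 0 0) = #|T|%:R.
    by under eq_bigr do rewrite mul0mx mxE e0; rewrite sumr_const.
  rewrite e0 mul1r addrAC subrr add0r.
  rewrite -[M%:R]ger0_norm // -normrM mulr_sumr.
  apply: (le_trans (ler_norm_sum _ _ _)).
  apply: (@le_trans _ _ (\sum_(i : 'rV['F_p]_m) #|T|%:R)); last first.
    by rewrite sumr_const card_mx card_Fp // mul1n natrM mulr_natl.
  rewrite [leRHS](bigD1 0) //= ler_wpDl //.
  apply: ler_sum => xi xi0.
  by rewrite !normrM expFp_norm mul1r ger0_norm // h.
have pt2 v : (M * (#|[set x | u x == v]| * p ^ m) <= (M + p ^ m) * #|T|)%N /\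
    (M * #|T| <= M * (#|[set x | u x == v]| * p ^ m) + p ^ m * #|T|)%N.
  have := pt v; rewrite -[M%:R]ger0_norm // -normrM mulrBr.
  rewrite real_ler_norml ?rpredB ?rpredM ?realn //.
  rewrite lerNl opprB !lerBlDr -!natrM -!natrD !ler_nat => /andP[]; lia.
move=> E; have cE : #|[set x | u x \in E]| = \sum_(v in E) #|[set x | u x == v]|.
  rewrite -sum1_card (partition_big u (mem E)) /=; last by move=> x; rewrite inE.
  apply: eq_bigr => v vE; rewrite -sum1_card; apply: eq_bigl => x; rewrite !inE.
  by case: eqP => [->|]; rewrite ?vE ?andbT ?andbF.
rewrite cE.
have cT : (#|T| * #|E| = \sum_(v in E) #|T|)%N by rewrite sum_nat_const mulnC.
rewrite cT big_distrl !big_distrr -big_split /=.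
by split; apply: leq_sum => v _; have [] := pt2 v.
Qed.
End ExpFp.

(** * The trigonometric profile *)

(* [-3 c_1 - c_2 + 4 c_3 + 6 c_4 + 3 c_5] at s, as a polynomial in x = cos s. *)
Definition profile_poly (R : realFieldType) (x : R) : R :=
  48 * x ^+ 5 + 48 * x ^+ 4 - 44 * x ^+ 3 - 50 * x ^+ 2 + 7.

(** The [b] are coefficients in the degree 5 Bernstein basis, whose members are nonnegative on
    [0, 1]. *)
Lemma bernstein5_ge0 (R : realFieldType) (b0 b1 b2 b3 b4 b5 t : R) :
  [&& 0 <= b0, 0 <= b1, 0 <= b2, 0 <= b3, 0 <= b4 & 0 <= b5] -> 0 <= t <= 1 ->
  0 <= b0 * (1 - t) ^+ 5 + b1 * (5 * t * (1 - t) ^+ 4)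
       + b2 * (10 * t ^+ 2 * (1 - t) ^+ 3) + b3 * (10 * t ^+ 3 * (1 - t) ^+ 2)
       + b4 * (5 * t ^+ 4 * (1 - t)) + b5 * t ^+ 5.
Proof.
move=> /and5P[? ? ? ? /andP[? ?]] /andP[t0]; rewrite -subr_ge0 => t1.
by rewrite !addr_ge0 ?mulr_ge0 ?exprn_ge0.
Qed.

(* On [-1, -1/2] and on [-1/2, 0] the Bernstein coefficients of
   [profile_poly - 3/8] are nonnegative. *)
Lemma profile_poly_low (R : realFieldType) (x : R) :
  -1 <= x <= 1 / 3 -> 3 / 8 <= profile_poly x.
Proof.
rewrite -subr_ge0 /profile_poly => /andP[h1 h2].
have [h|h] := lerP x (- (1 / 2)).
  have := @bernstein5_ge0 R (5 / 8) (89 / 40) (43 / 40) (9 / 40) (13 / 40) (9 / 8) (2 * (x + 1)).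
  rewrite !divr_ge0 // => /(_ isT) B.
  by apply: le_trans (B _) _; [lra | apply: eq_ler; field].
have [h'|h'] := lerP x 0.
  have := @bernstein5_ge0 R (9 / 8) (77 / 40) (137 / 40) (43 / 8) (53 / 8) (53 / 8) (2 * x + 1).
  rewrite !divr_ge0 // => /(_ isT) B.
  by apply: le_trans (B _) _; [lra | apply: eq_ler; field].
(* On [0, 1/3] the bound follows linearly, over the monomials in [t], from the nonnegative products
   listed next. *)
have [t xt] : exists t, x = 1 / 3 - t by exists (1 / 3 - x); lra.
have t0 : 0 <= t by lra.
have t1 : 0 <= 1 / 3 - t by lra.
have := mulr_ge0 t0 t1; have := mulr_ge0 (mulr_ge0 t0 t0) t1.
have := mulr_ge0 (exprn_ge0 4 t0) t1; have := exprn_ge0 4 t0.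
by rewrite xt; move: t0 t1; clear; lra.
Qed.

(** All Taylor coefficients of [profile_poly - 3/8] at 19/20 are nonnegative; the constant one only
    barely. *)
Lemma profile_poly_high (R : realFieldType) (x : R) :
  19 / 20 <= x -> 3 / 8 <= profile_poly x.
Proof.
rewrite -subr_ge0 => t0; rewrite -[x](subrK (19 / 20)) /profile_poly.
move: (x - _) t0 => t t0.
have := exprn_ge0 2 t0; have := exprn_ge0 3 t0; have := exprn_ge0 4 t0.
have := exprn_ge0 5 t0; lra.
Qed.

(* [8 x^4 - 8 x^2 + 1] is [cos 4s] for [x = cos s]. *)
Lemma profile_poly_dichotomy (R : realFieldType) (x : R) : -1 <= x <= 1 ->
  3 / 8 <= profile_poly x \/ 3 / 8 <= profile_poly (8 * x ^+ 4 - 8 * x ^+ 2 + 1).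
Proof.
move=> /andP[h1 h2].
have [h3|h3] := lerP x (1 / 3); first by left; apply: profile_poly_low; rewrite h1.
have [h4|h4] := lerP (19 / 20) x; first by left; apply: profile_poly_high.
(* For x between 1/3 and 19/20, [8 u^2 - 8 u + 1] with [u = x^2] is convex in [u] and below 1/3 at
   both ends of [1/9, 361/400]. *)
right; apply: profile_poly_low; apply/andP; split.
  have -> : 8 * x ^+ 4 - 8 * x ^+ 2 + 1 = 2 * (2 * x ^+ 2 - 1) ^+ 2 - 1 by ring.
  have := sqr_ge0 (2 * x ^+ 2 - 1); lra.
have u1 : 1 / 9 <= x ^+ 2 by nra.
have u2 : x ^+ 2 <= 361 / 400 by nra.
rewrite (_ : x ^+ 4 = x ^+ 2 ^+ 2); last by rewrite -exprM.
by move: (x ^+ 2) u1 u2 => u u1 u2; nra.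
Qed.

(** * Fourier inversion on ['F_p] and three-term averages *)

Section FourierSupport.
Variables (C : numClosedFieldType) (p : nat) (w : C).
Hypotheses (p_pr : prime p) (wp : w ^+ p = 1) (w1 : w != 1).
Let e := @expFp C w p.

Lemma fourier_inversion (c : 'F_p -> C) (r : 'F_p) :
  \sum_a (\sum_r' c r' * e (r' * a)) * e (- (r * a)) = p%:R * c r.
Proof.
under eq_bigr do rewrite mulr_suml.
rewrite exchange_big /=.
transitivity (\sum_r' c r' * \sum_a e ((r' - r) * a)).
  apply: eq_bigr => r' _; rewrite mulr_sumr; apply: eq_bigr => a _.
  by rewrite -mulrA -expFpD // mulrBl.
rewrite (bigD1 r) //= subrr sum_expFp // eqxx mulrC big1 ?addr0 // => r' rr.
by rewrite sum_expFp // subr_eq0 (negPf rr) mulr0.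
Qed.

(** Expanding only the third factor separates the sums over [a] and [b], which then pick out the
    coefficients at [r] and at [- (r *+ 2)]. *)
Lemma fourier_three_term (c : 'F_p -> C) (s : 'F_p) :
  let F a := \sum_r c r * e (r * a) in
  \sum_a \sum_b F a * F b * F (b *+ 2 - a + s)
    = (p ^ 2)%:R * \sum_r c r ^+ 2 * c (- (r *+ 2)) * e (r * s).
Proof.
move=> F.
transitivity (\sum_r c r * e (r * s) *
    ((\sum_a F a * e (- (r * a))) * (\sum_b F b * e (- (- (r *+ 2) * b))))).
  transitivity (\sum_a \sum_b \sum_r
      c r * e (r * s) * (F a * e (- (r * a)) * (F b * e (- (- (r *+ 2) * b))))).
    apply: eq_bigr => a _; apply: eq_bigr => b _.
    rewrite {3}/F mulr_sumr; apply: eq_bigr => r _.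
    have -> : r * (b *+ 2 - a + s) = r * s + (- (r * a) + - (- (r *+ 2) * b)).
      by ring.
    by rewrite /e !expFpD //; ring.
  under eq_bigr do rewrite exchange_big /=.
  rewrite exchange_big /=; apply: eq_bigr => r _.
  rewrite big_distrlr /= mulr_sumr; apply: eq_bigr => a _.
  by rewrite mulr_sumr.
rewrite mulr_sumr; apply: eq_bigr => r _.
rewrite !fourier_inversion; ring.
Qed.

End FourierSupport.

(** Since [2 * K < p], the residues [k] and [-k] with [1 <= k <= K] are all distinct, and with 0
    they cover the support. *)
Lemma sum_symmetric_support (V : nmodType) (p : nat) (h : 'F_p -> V) (K : nat) :
  prime p -> (2 * K < p)%N ->
  (forall r : 'F_p, (K < minn r (p - r))%N -> h r = 0) ->
  \sum_r h r = h 0 + \sum_(1 <= k < K.+1) (h k%:R + h (- k%:R)).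
Proof.
move=> p_pr Kp h0.
pose g i := h i%:R.
have -> : \sum_r h r = \sum_(0 <= i < p) g i.
  have -> : \sum_(0 <= i < p) g i = \sum_(0 <= i < (Zp_trunc (pdiv p)).+2) g i.
    by rewrite Fp_cast.
  by rewrite big_mkord; apply: eq_bigr => i _; rewrite /g natr_Zp.
rewrite big_ltn ?prime_gt0 //; congr (_ + _).
rewrite (@big_cat_nat _ _ _ K.+1) //=; last lia.
rewrite (@big_cat_nat _ _ _ (p - K) K.+1 p) //=; try lia.
rewrite [X in _ + (X + _)]big1_seq ?add0r; last first.
  move=> i /andP[_]; rewrite mem_index_iota => /andP[i1 i2].
  by apply: h0; rewrite val_Fp_nat // modn_small; lia.
rewrite big_split /=; congr (_ + _).
rewrite big_nat_rev /= (_ : (p - K)%N = (1 + (p - K.+1))%N); last lia.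
rewrite big_addn (_ : (p - (p - K.+1))%N = K.+1); last lia.
apply: eq_big_nat => i /andP[i1 i2]; rewrite /g; congr h.
apply/eqP; rewrite -subr_eq0 opprK -natrD.
have -> : (1 + (p - K.+1) + p - (i + (p - K.+1)).+1 + i = p)%N by lia.
by rewrite pchar_Fp_0.
Qed.

(* [cosine_coef k] is the Fourier coefficient of the profile at both k and -k. *)
Definition cosine_coef (R : realFieldType) (k : nat) : R :=
  nth 0 [:: 1 / 2; 1 / 24; 1 / 72; 1 / 36; 1 / 24; 1 / 24; - (1 / 24); 0; - (1 / 36); 0; - (1 / 72)] k.

(** The recurrence is that of [cos (k s)], so each [c k] is a Chebyshev polynomial in [c 1]. Terms
    with [k > 5] vanish because the coefficient at [2 k > 10] does. *)
Lemma cosine_coef_sum (R : realFieldType) (c : nat -> R) :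
  c 0%N = 1 -> (forall k, c k.+2 = 2 * c 1%N * c k.+1 - c k) ->
  1 / 8 + \sum_(1 <= k < 11) cosine_coef R k ^+ 2 * cosine_coef R k.*2 * (2 * c k)
  = 1 / 8 - (3 / 4) / 36 ^+ 3 * profile_poly (c 1%N).
Proof.
move=> c0 cS.
do 5! rewrite big_ltn //.
rewrite big_nat_cond big1 ?addr0; last first.
  by case=> [|[|[|[|[|[|k]]]]]] //= _; rewrite /cosine_coef /= ?nth_nil mulr0 mul0r.
rewrite /cosine_coef /= !cS c0; move: (c 1%N) => x.
rewrite /profile_poly.
by field.
Qed.

(** The nonconstant coefficients have absolute values summing to 1/4; doubled, they move the mean
    1/2 by at most 1/2. *)
Lemma cosine_coef_bound (R : realFieldType) (c : nat -> R) :
  (forall k, -1 <= c k <= 1) ->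
  0 <= cosine_coef R 0 + \sum_(1 <= k < 11) cosine_coef R k * (2 * c k) <= 1.
Proof.
move=> h; do 10! rewrite big_ltn //.
rewrite big_geq // /cosine_coef /= !mul0r.
move: (h 1%N) (h 2%N) (h 3%N) (h 4%N) (h 5%N) (h 6%N) (h 8%N) (h 10%N).
move: (c _) (c _) (c _) (c _) (c _) (c _) (c _) (c _) => x1 x2 x3 x4 x5 x6 x7 x8.
do 8! move=> /andP[? ?].
apply/andP; split; lra.
Qed.

Section Profile.
Variables (R : rcfType) (p : nat) (w : R[i]).
Hypotheses (p_pr : prime p) (p_gt40 : (40 < p)%N) (wp : w ^+ p = 1) (w1 : w != 1).
Let e := @expFp R[i] w p.
Local Notation re := (@complex.Re R).

Definition profile (a : 'F_p) : R :=
  cosine_coef R 0 + \sum_(1 <= k < 11) cosine_coef R k * (2 * re (e (k%:R * a))).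

Lemma expFp_addN a : e a + e (- a) = (2 * re (e a))%:C%C.
Proof.
rewrite /e -(character_conj (expFpD p_pr wp) (expFp_norm p_pr wp)) -/e.
by rewrite rmorphM /= complexRe ReE rmorph_nat mulrC divfK ?pnatr_eq0.
Qed.

Lemma re_expFp_bound a : -1 <= re (e a) <= 1.
Proof.
rewrite -ler_norml -lecR; apply: le_trans (normc_ge_Re _) _.
by rewrite expFp_norm.
Qed.

Lemma profile_bound a : 0 <= profile a <= 1.
Proof.
by apply: (cosine_coef_bound (c := fun k => re (e (k%:R * a)))) => k; apply: re_expFp_bound.
Qed.

(** Cyclic distance from [r] to 0, the same for [r] and [- r]. *)
Let fold (r : 'F_p) := minn r (p - r).

Lemma fold_natr k : (2 * k < p)%N -> fold k%:R = k.
Proof. by move=> kp; rewrite /fold val_Fp_nat // modn_small; lia. Qed.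

Lemma fold_oppr r : fold (- r) = fold r.
Proof.
have := ltn_ord r; rewrite /fold /=; move: (nat_of_ord r) => m; rewrite Fp_cast // => mp.
have [->|m0] := posnP m; first by rewrite subn0 modnn subn0 minnC.
rewrite modn_small; lia.
Qed.

Let coef (r : 'F_p) : R[i] := (cosine_coef R (fold r))%:C%C.

Lemma coef_out r : (10 < fold r)%N -> coef r = 0.
Proof.
by move=> h; rewrite /coef /cosine_coef nth_default.
Qed.

Lemma profile_fourier a : (profile a)%:C%C = \sum_r coef r * e (r * a).
Proof.
rewrite (@sum_symmetric_support _ _ _ 10 p_pr); first last.
- by move=> r hr; rewrite coef_out ?mul0r.
- lia.
rewrite /profile rmorphD rmorph_sum /= mul0r {2}/e /expFp expr0 mulr1.
rewrite /coef {1}/fold /= min0n; congr (_ + _).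
apply: eq_big_nat => k /andP[k1 k10].
rewrite fold_oppr fold_natr; last lia.
by rewrite rmorphM /= -expFp_addN mulrDr mulNr.
Qed.

(** On the unit circle [z^2 = 2 Re(z) z - 1]; this is the recurrence asked for by
    [cosine_coef_sum]. *)
Lemma re_exprSS (z : R[i]) k : `|z| = 1 ->
  re (z ^+ k.+2) = 2 * re z * re (z ^+ k.+1) - re (z ^+ k).
Proof.
move=> z1; have zz : z ^+ 2 = (2 * re z)%:C%C * z - 1.
  rewrite rmorphM /= complexRe ReE rmorph_nat mulrC [2 * _]mulrC divfK ?pnatr_eq0 //.
  by rewrite mulrDr -normCK z1 expr1n addrK expr2.
have -> : z ^+ k.+2 = (2 * re z)%:C%C * z ^+ k.+1 - z ^+ k.
  by rewrite -[k.+2]addn2 addnC exprD zz mulrBl mul1r exprS mulrA.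
by move: (z ^+ k.+1) (z ^+ k) (2 * re z) => [x y] [x' y'] r; rewrite /=; ring.
Qed.

Lemma profile_sum : \sum_a profile a = p%:R / 2.
Proof.
apply: (@complexI R); rewrite rmorph_sum /=.
transitivity (p%:R * coef 0).
  rewrite -(fourier_inversion p_pr wp w1); apply: eq_bigr => a _.
  by rewrite mul0r oppr0 [expFp w 0]expr0 mulr1 profile_fourier.
by rewrite /coef /fold min0n [RHS]rmorphM [in RHS]rmorph_nat /cosine_coef /= mul1r.
Qed.

Lemma profile_three_term s :
  \sum_a \sum_b profile a * profile b * profile (b *+ 2 - a + s)
  = (p ^ 2)%:R * (1 / 8 - (3 / 4) / 36 ^+ 3 * profile_poly (re (e s))).
Proof.
apply: (@complexI R); rewrite rmorph_sum /=.
transitivity ((p ^ 2)%:R * \sum_r coef r ^+ 2 * coef (- (r *+ 2)) * e (r * s)).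
  rewrite -(fourier_three_term p_pr wp w1); apply: eq_bigr => a _.
  rewrite rmorph_sum /=; apply: eq_bigr => b _.
  by rewrite !rmorphM /= !profile_fourier.
rewrite [RHS]rmorphM rmorph_nat; congr (_ * _).
rewrite (@sum_symmetric_support _ _ _ 10 p_pr); first last.
- by move=> r hr; rewrite coef_out ?expr0n ?mul0r.
- lia.
have -> : coef 0 ^+ 2 * coef (- (0 *+ 2)) * e (0 * s) = (1 / 8)%:C%C.
  rewrite mul0rn oppr0 mul0r {1}/e /expFp expr0 mulr1 -exprSr /coef /fold min0n.
  by rewrite -rmorphXn /=; congr (_%:C)%C; rewrite /cosine_coef /=; by field.
transitivity ((1 / 8)%:C%C + \sum_(1 <= k < 11)
  (cosine_coef R k ^+ 2 * cosine_coef R k.*2 * (2 * re (e s ^+ k)))%:C%C : R[i]).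
  congr (_ + _); apply: eq_big_nat => k /andP[k1 k10].
  rewrite -expFpMn // -[s *+ k]mulr_natl rmorphM /= -expFp_addN.
  rewrite /coef mulNrn opprK !fold_oppr -mulrnA muln2.
  (* Here [40 < p] is used: the index [2 k] goes up to 20 and must be its own folded value. *)
  rewrite !fold_natr; [|lia..].
  by rewrite rmorphM rmorphXn mulrDr mulNr.
rewrite -rmorph_sum -rmorphD /=; congr (_%:C)%C.
have z1 : `|e s| = 1 by rewrite expFp_norm.
apply: (cosine_coef_sum (c := fun k => re (e s ^+ k))) => [|k]; first by rewrite expr0.
by rewrite expr1 re_exprSS.
Qed.
End Profile.

(** * The structured set *)

(** Squares and fifth powers require a multiplication, so the additive group ['F_p^n] is identified
    with that of the field of [p ^ n] elements. *)
Lemma field_coordinates (p n : nat) : prime p -> (0 < n)%N ->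
  exists (K : finFieldType) (g : K -> 'rV['F_p]_n),
    [/\ p \in [pchar K], forall x y, g (x + y) = g x + g y & bijective g].
Proof.
move=> p_pr n0; have [K chK cK] := pPrimePowerField p_pr n0.
exists K; have := pprimeChar_vectAxiom chK.
rewrite (_ : logn p _ = n); last by rewrite cK pfactorK.
case=> g glin gbij; exists g; split=> // x y.
by have := glin 1 x y; rewrite !scale1r.
Qed.

(** The exact degree is unknown, so vanishing leading coefficients are stripped until [weyl_bound]
    applies. *)
Lemma weyl_bound_deg5 (C : numClosedFieldType) (m : nat) :
  exists N : nat, forall (K : finFieldType) (psi : K -> C),
    (forall x y, psi (x + y) = psi x * psi y) -> (forall x, `|psi x| = 1) ->
    (exists x, psi x != 1) ->
    (forall i, (0 < i <= 5)%N -> (i%:R : K) != 0) -> (N <= #|K|)%N ->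
    forall c : nat -> K, (exists i, (0 < i <= 5)%N && (c i != 0)) ->
    m%:R * `|\sum_x psi (\sum_(i < 6) c i * x ^+ i)| <= #|K|%:R.
Proof.
have [N0 h0] := weyl_bound C 0 m; have [N1 h1] := weyl_bound C 1 m.
have [N2 h2] := weyl_bound C 2 m; have [N3 h3] := weyl_bound C 3 m.
have [N4 h4] := weyl_bound C 4 m.
exists (N0 + N1 + N2 + N3 + N4)%N => K psi psiD psi1 nt char5 NK c cn0.
have drop k : c k.+1 = 0 -> \sum_x psi (\sum_(i < k.+2) c i * x ^+ i)
    = \sum_x psi (\sum_(i < k.+1) c i * x ^+ i).
  by move=> ck; apply: eq_bigr => x _; rewrite big_ord_recr /= ck mul0r addr0.
have char k : (k <= 5)%N -> forall i, (0 < i <= k)%N -> (i%:R : K) != 0.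
  by move=> k5 i /andP[i0 ik]; apply: char5; rewrite i0 (leq_trans ik).
have [c5|c5] := eqVneq (c 5%N) 0; last by apply: (h4 K psi psiD psi1 nt _ _ c c5); [apply: char | lia].
rewrite drop //.
have [c4|c4] := eqVneq (c 4%N) 0; last by apply: (h3 K psi psiD psi1 nt _ _ c c4); [apply: char | lia].
rewrite drop //.
have [c3|c3] := eqVneq (c 3%N) 0; last by apply: (h2 K psi psiD psi1 nt _ _ c c3); [apply: char | lia].
rewrite drop //.
have [c2|c2] := eqVneq (c 2%N) 0; last by apply: (h1 K psi psiD psi1 nt _ _ c c2); [apply: char | lia].
rewrite drop //.
have [c1|c1] := eqVneq (c 1%N) 0; last by apply: (h0 K psi psiD psi1 nt _ _ c c1); [apply: char | lia].
by have [[|[|[|[|[|[|i]]]]]] /andP[]] := cn0; rewrite ?c1 ?c2 ?c3 ?c4 ?c5 ?eqxx.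
Qed.

Definition row5 (T : Type) (a b c d e : T) : 'rV[T]_5 := \row_i nth a [:: a; b; c; d; e] i.

(* A nonzero combination of the five coordinates is a polynomial in x of degree
   between 1 and 5: the coefficients of x^5, x^4, x^3 determine the weights of
   the fifth powers, and those of x^2, x the weights of the squares. *)
Lemma progression_tuple_bound (C : numClosedFieldType) (p m : nat) (w : C) :
  prime p -> (5 < p)%N -> w ^+ p = 1 -> w != 1 ->
  exists N : nat, forall (K : finFieldType) (tau : K -> 'F_p),
    p \in [pchar K] -> (forall x y, tau (x + y) = tau x + tau y) ->
    (exists x, tau x != 0) -> (N <= #|K|)%N ->
    forall (d : K) (xi : 'rV['F_p]_5), d != 0 -> xi != 0 ->
    m%:R * `|\sum_x expFp w ((xi *m (row5 (tau (x ^+ 2)) (tau ((x + d) ^+ 2))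
       (tau (x ^+ 5)) (tau ((x + d) ^+ 5)) (tau ((x + d *+ 2) ^+ 5)))^T) 0 0)| <= #|K|%:R.
Proof.
move=> p_pr p5 wp w1; have [N hN] := weyl_bound_deg5 C m.
exists N => K tau chK tauD [x0 tx0] NK d xi d0 xi0.
have tau0 : tau 0 = 0 by apply: (addrI (tau 0)); rewrite -tauD !addr0.
have tauMn k y : tau (k%:R * y) = k%:R * tau y.
  elim: k => [|k IH]; first by rewrite !mul0r tau0.
  by rewrite -[k.+1]add1n !natrD !mulrDl !mul1r tauD IH.
have char i : (0 < i < p)%N -> (i%:R : K) != 0.
  by move=> /andP[i0 ip]; rewrite -(dvdn_pcharf chK) gtnNdvd.
(* The weights are lifted to the prime field of [K], so that they can be moved inside [tau]. *)
pose v (i : 'I_5) : K := (xi 0 i : nat)%:R.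
have tauv i y : xi 0 i * tau y = tau (v i * y) by rewrite tauMn natr_Zp.
pose a := v 0; pose b := v 1; pose l := v 2; pose q := v 3; pose r := v 4.
(* Coefficients of [a x^2 + b (x+d)^2 + l x^5 + q (x+d)^5 + r (x+2d)^5] in [x]. *)
pose c := nth 0 [:: b * d ^+ 2 + d ^+ 5 * (q + r *+ 32);
  b * d *+ 2 + d ^+ 4 *+ 5 * (q + r *+ 16);
  a + b + d ^+ 3 *+ 10 * (q + r *+ 8);
  d ^+ 2 *+ 10 * (q + r *+ 4); d *+ 5 * (q + r *+ 2); l + q + r].
under eq_bigr => x _.
  rewrite mxE !big_ord_recl big_ord0 addr0 !mxE /= !tauv -!tauD.
  rewrite (_ : _ + _ = \sum_(i < 6) c i * x ^+ i).
    over.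
  rewrite !big_ord_recl big_ord0 /= /bump /= /c /=.
  have -> : v (lift ord0 ord0) = b by congr v; apply: val_inj.
  have -> : v (lift ord0 (lift ord0 ord0)) = l by congr v; apply: val_inj.
  have -> : v (lift ord0 (lift ord0 (lift ord0 ord0))) = q by congr v; apply: val_inj.
  have -> : v (lift ord0 (lift ord0 (lift ord0 (lift ord0 ord0)))) = r.
    by congr v; apply: val_inj.
  by rewrite -/a; ring.
apply: (hN K (fun y => expFp w (tau y))) => //.
- by move=> x y; rewrite tauD expFpD.
- by move=> x; rewrite expFp_norm.
- by exists x0; apply: expFp_neq1.
- by move=> i /andP[i0 i5]; apply: char; rewrite i0 (leq_ltn_trans i5).
have [/existsP[i /andP[i0 ci]]|/existsPn hc] := boolP [exists i : 'I_6, (0 < i)%N && (c i != 0)].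
  by exists i; rewrite i0 -ltnS ltn_ord.
have {}hc i : (0 < i < 6)%N -> c i = 0.
  by case/andP=> i0 i6; have := hc (Ordinal i6); rewrite /= i0 negbK => /eqP.
have n2 : (2%:R : K) != 0 by apply: char; lia.
have n5 : (5%:R : K) != 0 by apply: char; lia.
have c5 := hc 5%N isT; have c4 := hc 4%N isT; have c3 := hc 3%N isT.
have c2 := hc 2%N isT; have c1 := hc 1%N isT; rewrite /c /= in c1 c2 c3 c4 c5.
have e4 : q + r *+ 2 = 0.
  by move/eqP: c4; rewrite -mulr_natr !mulf_eq0 (negPf d0) (negPf n5) => /eqP.
have e3 : q + r *+ 4 = 0.
  move/eqP: c3; rewrite -mulr_natr (_ : 10%:R = 2%:R * 5%:R) -?natrM //.
  by rewrite !mulf_eq0 (negPf d0) natrM mulf_eq0 (negPf n2) (negPf n5) => /eqP.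
have r0 : r = 0.
  have : r * 2%:R = (q + r *+ 4) - (q + r *+ 2) by ring.
  rewrite e3 e4 subr0; move/eqP; by rewrite mulf_eq0 (negPf n2) orbF => /eqP.
have q0 : q = 0 by move: e4; rewrite r0 mul0rn addr0.
have l0 : l = 0 by move: c5; rewrite r0 q0 !addr0.
have b0 : b = 0.
  have /eqP : b * d * 2%:R = 0 by move: c1; rewrite r0 q0 => <-; ring.
  by rewrite !mulf_eq0 (negPf d0) (negPf n2) !orbF => /eqP.
have a0 : a = 0 by move: c2; rewrite r0 q0 b0 => <-; ring.
have v0 i : v i = 0.
  have : [|| i == 0, i == 1, i == 2, i == 3 | i == 4].
    by case: i => [[|[|[|[|[|i]]]]]].
  by case/or4P => [/eqP->|/eqP->|/eqP->|/orP[]/eqP->].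
case/eqP: xi0; apply/rowP => i; rewrite mxE -[LHS]natr_Zp.
have := v0 i; rewrite /v => /eqP; rewrite -(dvdn_pcharf chK) => h.
by apply/eqP; rewrite -(dvdn_pcharf (pchar_Fp p_pr)).
Qed.

Lemma sum_row5 (F : finType) (G : 'rV[F]_5 -> nat) :
  (\sum_w G w = \sum_a \sum_b \sum_c \sum_d \sum_e G (row5 a b c d e))%N.
Proof.
rewrite (reindex (fun t : F * (F * (F * (F * F))) =>
  row5 t.1 t.2.1 t.2.2.1 t.2.2.2.1 t.2.2.2.2)); last first.
  exists (fun w : 'rV[F]_5 => (w 0 0, (w 0 1, (w 0 2, (w 0 3, w 0 4))))) => [[a [b [c [d e]]]] _|w _].
    by rewrite !mxE.
  apply/rowP => i; rewrite mxE /=.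
  by case: i => [[|[|[|[|[|i]]]]]] //= h; congr (w _ _); apply: val_inj.
rewrite -(pair_bigA _ (fun a t => G (row5 a t.1 t.2.1 t.2.2.1 t.2.2.2))) /=.
apply: eq_bigr => a _; rewrite -(pair_bigA _ (fun b t => G (row5 a b t.1 t.2.1 t.2.2))) /=.
apply: eq_bigr => b _; rewrite -(pair_bigA _ (fun c t => G (row5 a b c t.1 t.2))) /=.
by apply: eq_bigr => c _; rewrite -(pair_bigA _ (fun d e => G (row5 a b c d e))).
Qed.

Lemma sum_ltn_Fp (p A : nat) : prime p -> (A <= p)%N -> (\sum_(c : 'F_p) (c < A) = A)%N.
Proof.
move=> p_pr Ap.
have h : (A <= (Zp_trunc (pdiv p)).+2)%N by rewrite Fp_cast.
rewrite (_ : \sum_(c : 'F_p) _ = \sum_(i < (Zp_trunc (pdiv p)).+2 | (i < A)%N) 1)%N.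
  by rewrite -(big_ord_widen _ (fun=> 1%N)) // sum_nat_const card_ord muln1.
by rewrite [RHS]big_mkcond; apply: eq_bigr => i _; case: ifP.
Qed.

(** Once coordinates 0 and 1 are fixed, coordinates 2, 3 and 4 are free, and each threshold
    contributes its own factor. *)
Lemma card_triple_below (p : nat) (t : 'F_p -> nat) (h : 'F_p -> 'F_p -> 'F_p) :
  prime p -> (forall a, (t a <= p)%N) ->
  #|[set w : 'rV['F_p]_5 | [&& ((w 0 2)%R < t (w 0 0)%R), ((w 0 3)%R < t (w 0 1)%R)
      & ((w 0 4)%R < t (h (w 0 0) (w 0 1))%R)]%N]| =
  (\sum_a \sum_b t a * t b * t (h a b))%N.
Proof.
move=> p_pr tp; rewrite -sum1_card big_mkcond sum_row5.
apply: eq_bigr => a _; apply: eq_bigr => b _.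
rewrite -[in RHS](sum_ltn_Fp p_pr (tp a)) -[in RHS](sum_ltn_Fp p_pr (tp b)).
rewrite -[in RHS](sum_ltn_Fp p_pr (tp (h a b))) -mulnA big_distrl /=.
apply: eq_bigr => c _; rewrite big_distrlr big_distrr /=.
apply: eq_bigr => d _; rewrite big_distrr /=.
apply: eq_bigr => e _; rewrite inE !mxE /=.
by do 3!case: (_ < _)%N.
Qed.

Lemma card_single_below (p : nat) (t : 'F_p -> nat) :
  prime p -> (forall a, (t a <= p)%N) ->
  #|[set w : 'rV['F_p]_5 | ((w 0 2)%R < t (w 0 0)%R)%N]| = (p ^ 3 * \sum_a t a)%N.
Proof.
move=> p_pr tp; rewrite -sum1_card big_mkcond sum_row5 big_distrr /=.
apply: eq_bigr => a _; rewrite -[in RHS](sum_ltn_Fp p_pr (tp a)).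
rewrite (eq_bigr (fun=> p ^ 2 * \sum_(c : 'F_p) (c < t a)))%N.
  by rewrite sum_nat_const card_Fp // mulnA.
move=> b _; rewrite big_distrr /=; apply: eq_bigr => c _.
rewrite (eq_bigr (fun=> p * (c < t a)))%N.
  by rewrite sum_nat_const card_Fp // mulnA.
move=> d _; rewrite (eq_bigr (fun=> (c < t a) : nat))%N.
  by rewrite sum_nat_const card_Fp.
by move=> e _; rewrite inE !mxE /=; case: ltnP.
Qed.

(* Membership of x, x + d, x + 2d only depends on an equidistributed 5-tuple,
   because Q x = tau (x^2) satisfies Q (x + 2d) = 2 Q (x + d) - Q x + 2 Q d. *)
Lemma structured_set (p L : nat) (C : numClosedFieldType) (w : C) (t : 'F_p -> nat) :
  prime p -> (5 < p)%N -> w ^+ p = 1 -> w != 1 -> (0 < L)%N ->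
  (forall a, (t a <= p)%N) ->
  exists N : nat, forall n : nat, (N <= n)%N ->
  exists (A : {set 'rV['F_p]_n}) (q : 'rV['F_p]_n -> 'F_p),
  [/\ forall d, q (d *+ 2) = q d *+ 4,
     (L * (p ^ n * \sum_a t a) <= L * (#|A| * p ^ 2) + p ^ n * \sum_a t a)%N &
     forall d, d != 0 ->
     (L * (#|[set x | [&& x \in A, (x + d)%R \in A & (x + d *+ 2)%R \in A]]| * p ^ 5)
      <= L.+1 * (p ^ n * \sum_a \sum_b t a * t b * t (b *+ 2 - a + q d)%R))%N].
Proof.
move=> p_pr p5 wp w1 L0 tp.
(* Equidistribution in dimension 5 has relative error [p ^ 5 / M]; [M = p ^ 5 * L] turns it into
   [1 / L]. *)
have [N hN] := progression_tuple_bound (p ^ 5 * L) p_pr p5 wp w1.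
exists N.+1 => n Nn; have n0 : (0 < n)%N by lia.
have [K [g [chK gD [g' gK g'K]]]] := field_coordinates p_pr n0.
have cK : #|K| = (p ^ n)%N.
  by rewrite -(card_Fp p_pr) -[n in RHS]mul1n -card_mx; apply: bij_eq_card; exists g'; eassumption.
pose tau x := g x 0 (Ordinal n0).
have tauD x y : tau (x + y) = tau x + tau y by rewrite /tau gD mxE.
have nt : exists x, tau x != 0.
  by exists (g' (delta_mx 0 (Ordinal n0))); rewrite /tau g'K mxE !eqxx oner_eq0.
have NK : (N <= #|K|)%N.
  by rewrite cK; apply: leq_trans (ltnW (ltn_expl n (prime_gt1 p_pr))); lia.
pose u d x := row5 (tau (x ^+ 2)) (tau ((x + d) ^+ 2))
  (tau (x ^+ 5)) (tau ((x + d) ^+ 5)) (tau ((x + d *+ 2) ^+ 5)).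
have eqd d : d != 0 -> forall E : {set 'rV['F_p]_5}, 
    (L * (#|[set x | u d x \in E]| * p ^ 5) <= L.+1 * (p ^ n * #|E|))%N /\
    (L * (p ^ n * #|E|) <= L * (#|[set x | u d x \in E]| * p ^ 5) + p ^ n * #|E|)%N.
  move=> d0 E.
  have := @equidistribution C p w p_pr wp w1 K 5 (p ^ 5 * L) (u d) _ E.
  case; first by move=> xi xi0; apply: hN.
  have p50 : (0 < p ^ 5)%N by rewrite expn_gt0 prime_gt0.
  rewrite cK; move: (p ^ 5)%N p50 => P P0.
  by move=> h1 h2; split; rewrite -(leq_pmul2l P0); lia.
pose D := [set x : K | (tau (x ^+ 5) < t (tau (x ^+ 2)))%N].
have gI : injective g by apply: can_inj gK.
have g0 : g 0 = 0 by apply: (addrI (g 0)); rewrite -gD !addr0.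
have gA x : (g x \in g @: D) = (x \in D) by rewrite mem_imset.
pose q v := tau (g' v ^+ 2) *+ 2.
have tau2 d x : tau ((x + d *+ 2) ^+ 2) = tau ((x + d) ^+ 2) *+ 2 - tau (x ^+ 2) + tau (d ^+ 2) *+ 2.
  have : tau ((x + d *+ 2) ^+ 2 + x ^+ 2) = tau ((x + d) ^+ 2 + (x + d) ^+ 2 + (d ^+ 2 + d ^+ 2)).
    by congr tau; ring.
  by rewrite !tauD => h; rewrite -[LHS](addrK (tau (x ^+ 2))) h; ring.
exists (g @: D), q; split.
- move=> v; rewrite /q -mulrnA -[v]g'K; set d := g' v.
  have -> : g' (g d *+ 2) = d *+ 2 by rewrite !mulr2n -gD !gK.
  rewrite gK (_ : (d *+ 2) ^+ 2 = d ^+ 2 + d ^+ 2 + (d ^+ 2 + d ^+ 2)); last by ring.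
  by rewrite !tauD; ring.
(* The size of [D] involves only coordinates 0 and 2, which do not depend on the shift; 1 is just
   some nonzero shift. *)
- have [_] := eqd 1 (oner_neq0 _) [set w : 'rV['F_p]_5 | ((w 0 2)%R < t (w 0 0)%R)%N].
  rewrite card_single_below // card_imset //.
  rewrite (_ : [set x | _] = D); last by apply/setP => x; rewrite !inE !mxE.
  have p30 : (0 < p ^ 3)%N by rewrite expn_gt0 prime_gt0.
  move=> H; rewrite -(leq_pmul2l p30); move: H; rewrite (expnD p 3 2).
  by move: (p ^ 3)%N (p ^ 2)%N (p ^ n)%N (\sum_a t a)%N => a b e f; lia.
- move=> v v0.
  have d0 : g' v != 0 by apply: contraNneq v0 => h; rewrite -[v]g'K h g0.
  have [+ _] := eqd _ d0 [set w : 'rV['F_p]_5 | [&& ((w 0 2)%R < t (w 0 0)%R), ((w 0 3)%R < t (w 0 1)%R)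
      & ((w 0 4)%R < t (w 0 1 *+ 2 - w 0 0 + q v)%R)]%N].
  rewrite (card_triple_below (fun a b => b *+ 2 - a + q v)) //.
  set S := [set x | u _ x \in _]; set S' := [set x | _].
  suff -> : #|S'| = #|S| by [].
  have -> : S' = g @: S; last by rewrite card_imset.
  apply/setP => y; rewrite -[y]g'K (mem_imset _ _ gI) /S /S'; move: (g' y) => {y} x.
  have e1 : g x + v = g (x + g' v) by rewrite gD g'K.
  have e2 : g x + v *+ 2 = g (x + g' v *+ 2) by rewrite !mulr2n !gD g'K.
  by rewrite !inE e1 e2 !gA !inE !mxE /= tau2.
Qed.

(** * Counting progressions and adjusting the density *)

Definition progressions (V : finZmodType) (A : {set V}) (d : V) : {set V} :=
  [set x | [&& x \in A, x + d \in A & x + d *+ 2 \in A]].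

Lemma I3_ind (R : realType) (p n : nat) (A : {set 'rV['F_p]_n}) d : prime p ->
  I3 (ind R A) d = #|progressions A d|%:R / (p ^ n)%:R.
Proof.
move=> p_pr; rewrite /I3 /expect /ind card_mx card_Fp // mul1n mulrC; congr (_ / _).
rewrite -sum1_card natr_sum [RHS]big_mkcond; apply: eq_bigr => x _.
by rewrite inE; do 3!case: (_ \in _); rewrite /= ?mulr1 ?mulr0 ?mul0r.
Qed.

(** A progression in [A] but not in [B] has one of its three points in [A :\: B], and each position
    accounts for one translate of that set. *)
Lemma card_progressions_le (V : finZmodType) (A B : {set V}) (d : V) :
  (#|progressions A d| <= #|progressions B d| + 3 * #|A :\: B|)%N.
Proof.
pose T (v : V) := [set x | x + v \in A :\: B].
have cT v : #|T v| = #|A :\: B|.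
  rewrite -[RHS](card_preimset _ (addIr v)); by apply: eq_card => x; rewrite !inE.
have sub : progressions A d \subset
    progressions B d :|: (T 0 :|: (T d :|: T (d *+ 2))).
  apply/fintype.subsetP => x; rewrite !inE addr0 => /and3P[-> -> ->]; rewrite !andbT.
  by do 3!case: (_ \in B).
apply: leq_trans (subset_leq_card sub) _.
rewrite !mulSn mul0n addn0.
apply: leq_trans (leq_card_setU _ _).1 _; rewrite leq_add2l.
apply: leq_trans (leq_card_setU _ _).1 _; rewrite cT leq_add2l.
by apply: leq_trans (leq_card_setU _ _).1 _; rewrite !cT.
Qed.

(** Only the added elements are controlled, since deleting elements creates no progression. *)
Lemma resize_set (T : finType) (A : {set T}) (k : nat) : (k <= #|T|)%N ->
  exists B : {set T}, #|B| = k /\ (#|B :\: A| <= k - #|A|)%N.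
Proof.
move=> kT.
have sub (S : {set T}) j : (j <= #|S|)%N -> exists B : {set T}, B \subset S /\ #|B| = j.
  move=> jS; exists [set x in take j (enum S)]; split.
    by apply/fintype.subsetP => x; rewrite inE => /mem_take; rewrite mem_enum.
  by rewrite cardsE (card_uniqP _) ?take_uniq ?enum_uniq // size_takel // -cardE.
have [kA|Ak] := leqP k #|A|.
  have [B [BA cB]] := sub A k kA; exists B; split=> //.
  by move: BA; rewrite -finset.setD_eq0 => /eqP->; rewrite cards0.
have [|B [BA cB]] := sub (~: A) (k - #|A|)%N; first by have := cardsC A; lia.
exists (A :|: B); split.
  by rewrite cardsU disjoint_setI0 ?cards0 ?cB; [lia | rewrite disjoint_sym finset.disjoints_subset].
by rewrite finset.setDUl finset.setDv finset.set0U -cB subset_leq_card ?finset.subsetDl.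
Qed.

(** * Limiting density and assembly of the sets *)

Local Open Scope classical_set_scope.
Local Open Scope ring_scope.

(** Rounding down costs at most [1 / (2 p^n)], and [n < p ^ n] makes this small as soon as [n]
    exceeds [1 / eps]. *)
Lemma half_density_cvg (R : realType) (p N : nat) (A : forall n, {set 'rV['F_p]_n}) :
  prime p -> (forall n, (N <= n)%N -> #|A n| = (p ^ n)./2) ->
  (fun n : nat => density R (A n)) @ \oo --> (1 / 2 : R).
Proof.
move=> p_pr hA; apply/cvgrPdist_le => eps eps0.
exists (maxn N (Num.truncn eps^-1).+1) => // n /=.
rewrite geq_max => /andP[Nn en].
have n_lt : (n < p ^ n)%N by rewrite ltn_expl ?prime_gt1.
have q0 : 0 < (p ^ n)%:R :> R by rewrite ltr0n; lia.
have qe : eps^-1 <= (p ^ n)%:R.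
  by apply: le_trans (ltW (truncnS_gt _)) _; rewrite ler_nat (leq_trans en) 1?ltnW.
rewrite /density hA //.
have h : (p ^ n)%:R = (odd (p ^ n))%:R + 2 * (p ^ n)./2%:R :> R.
  by rewrite -natrM -natrD mul2n odd_double_half.
have -> : 1 / 2 - (p ^ n)./2%:R / (p ^ n)%:R = (odd (p ^ n))%:R / 2 / (p ^ n)%:R :> R.
  have -> : (p ^ n)./2%:R = ((p ^ n)%:R - (odd (p ^ n))%:R) / 2 :> R by rewrite h; field.
  by move: q0; move: (p ^ n)%:R (odd _)%:R => q o q0; field; rewrite gt_eqF.
rewrite ger0_norm ?divr_ge0 // ler_pdivrMr //.
have e1 : 1 <= eps * (p ^ n)%:R by rewrite -ler_pdivrMl // mulr1.
by case: odd => /=; lra.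
Qed.

Lemma re_expFp_mul4 (R : rcfType) (p : nat) (w : R[i]) (s : 'F_p) :
  prime p -> w ^+ p = 1 -> 
  complex.Re (expFp w (s *+ 4)) =
  8 * complex.Re (expFp w s) ^+ 4 - 8 * complex.Re (expFp w s) ^+ 2 + 1.
Proof.
move=> p_pr wp; rewrite expFpMn // !re_exprSS ?expFp_norm // expr1 expr0 /=; ring.
Qed.

(* With [t] the integer part of [p * profile], the set of [structured_set] behaves
   like a random set containing x with probability [profile (tau (x^2))]. *)
Lemma few_progressions (R : realType) (p : nat) : prime p -> (40 < p)%N ->
  exists N : nat, forall n, (N <= n)%N -> exists A : {set 'rV['F_p]_n},
    (1 / 2 - 2 / p%:R) * (p ^ n)%:R <= #|A|%:R :> R /\
    forall d, d != 0 -> Num.min (I3 (ind R A) d) (I3 (ind R A) (d *+ 2))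
      <= 1 / 8 - (9 / 32) / 36 ^+ 3 + 1 / p%:R.
Proof.
move=> p_pr p40; have [w [wp w1]] := nontrivial_root_of_unity R[i] p_pr.
have p0 : 0 < p%:R :> R by rewrite ltr0n prime_gt0.
pose f := profile w : 'F_p -> R.
have f01 a : 0 <= f a <= 1 by apply: profile_bound.
pose t a := Num.truncn (p%:R * f a).
have t_itv a : (t a)%:R <= p%:R * f a < (t a).+1%:R.
  by apply: truncn_itv; have /andP[? _] := f01 a; rewrite mulr_ge0 // ltW.
have tp a : (t a <= p)%N.
  rewrite -(ler_nat R); have /andP[h _] := t_itv a; apply: le_trans h _.
  by have /andP[_ h] := f01 a; rewrite -[leRHS]mulr1 ler_wpM2l // ltW.
have [|N hN] := structured_set p_pr _ wp w1 (prime_gt0 p_pr) tp; first lia.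
exists N => n Nn; have [A [q [q2 cA pA]]] := hN n Nn.
have q0 : 0 < (p ^ n)%:R :> R by rewrite ltr0n expn_gt0 prime_gt0.
pose H d := profile_poly (complex.Re (expFp w (q d))) : R.
(* Rounding [t] down only lowers the count; the factor [1 + 1/p] is the equidistribution error with
   [L = p]. *)
have bound d : d != 0 ->
    I3 (ind R A) d <= (1 + 1 / p%:R) * (1 / 8 - (3 / 4) / 36 ^+ 3 * H d).
  move=> d0; rewrite I3_ind //.
  have sumt : (\sum_a \sum_b t a * t b * t (b *+ 2 - a + q d)%R)%:R
      <= p%:R ^+ 5 * (1 / 8 - (3 / 4) / 36 ^+ 3 * H d).
    rewrite (_ : 5%N = (3 + 2)%N) // exprD -mulrA -[p%:R ^+ 2]natrX -(profile_three_term p_pr p40 wp w1).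
    rewrite natr_sum mulr_sumr; apply: ler_sum => a _.
    rewrite natr_sum mulr_sumr; apply: ler_sum => b _.
    rewrite !natrM [leRHS](_ : _ = (p%:R * f a) * (p%:R * f b) * (p%:R * f (b *+ 2 - a + q d))).
      have [/andP[h1 _] /andP[h2 _] /andP[h3 _]] := And3 (t_itv a) (t_itv b) (t_itv (b *+ 2 - a + q d)).
      by rewrite !ler_pM // mulr_ge0.
    by rewrite /f; ring.
  have := pA d d0; rewrite -(ler_nat R) -/(progressions A d) natrM natrM [in leRHS]natrM [in leRHS]natrM => h.
  rewrite ler_pdivrMr // -(ler_pM2l (mulr_gt0 p0 (exprn_gt0 5 p0))).
  have p10 : 0 <= p.+1%:R * (p ^ n)%:R :> R by rewrite mulr_ge0.
  have := ler_wpM2l p10 sumt; rewrite -[leLHS]mulrA => h'; have {h h'} := le_trans h h'.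
  rewrite natrX -natr1; move: (#|_|)%:R (p ^ n)%:R (_ - _) => P Q y {}h.
  rewrite (_ : _ * P = p%:R * (P * p%:R ^+ 5)); last by ring.
  by apply: le_trans h _; apply: eq_ler; field; rewrite gt_eqF.
exists A; split.
  (* The density loses [1/p] twice: the floors lower the sum of [t] by at most [p], and
     equidistribution costs a further [1/p] of that sum, which is at most [p ^ 2]. *)
  have st1 : (\sum_a t a)%:R <= p%:R ^+ 2 :> R.
    have : \sum_a (t a)%:R <= \sum_(a : 'F_p) p%:R :> R.
      by apply: ler_sum => a _; rewrite ler_nat.
    by rewrite natr_sum sumr_const card_Fp // -[_ *+ p]mulr_natr -expr2.
  have st2 : p%:R ^+ 2 / 2 - p%:R <= (\sum_a t a)%:R :> R.
    have -> : p%:R ^+ 2 / 2 - p%:R = \sum_a (p%:R * f a - 1).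
      rewrite sumrB -mulr_sumr (profile_sum p_pr p40 wp w1) sumr_const card_Fp //; ring.
    rewrite natr_sum; apply: ler_sum => a _.
    by have /andP[_] := t_itv a; rewrite -natr1 lerBlDr => /ltW.
  move: cA; rewrite -(ler_nat R) natrD !natrM.
  move: (p ^ n)%:R q0 (\sum_a t a)%:R st1 st2 (#|A|)%:R => Q Q0 s s1 s2 c h.
  have p1 : 1 <= p%:R :> R by rewrite ler1n prime_gt0.
  rewrite -(ler_pM2l (exprn_gt0 3 p0)).
  apply: (@le_trans _ _ (Q * (p%:R * s - s))).
    rewrite [leLHS](_ : _ = Q * (p%:R * (p%:R ^+ 2 / 2 - p%:R) - p%:R ^+ 2)).
      by rewrite ler_pM2l // lerB // ler_pM2l.
    by field; rewrite gt_eqF.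
  by rewrite mulrBr lerBlDr mulrCA; apply: le_trans h _; apply: eq_ler; ring.
(* The saving is [(3/4) * (3/8) = 9/32], over [36 ^ 3]. *)
have small d : d != 0 -> 3 / 8 <= H d ->
    I3 (ind R A) d <= 1 / 8 - (9 / 32) / 36 ^+ 3 + 1 / p%:R.
  move=> d0 hH; apply: le_trans (bound d d0) _.
  have ip : 0 <= 1 / p%:R :> R by rewrite divr_ge0 ?ltW.
  move: (1 / p%:R) ip (H d) hH => x x0 y y0; nra.
move=> d d0.
have [|h|h] := @profile_poly_dichotomy R (complex.Re (expFp w (q d))).
- exact: re_expFp_bound.
- by rewrite ge_min small.
rewrite ge_min [X in _ || X]small ?orbT //.
  rewrite -scaler_nat scaler_eq0 (negPf d0) orbF -(dvdn_pcharf (pchar_Fp p_pr)).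
  by rewrite gtnNdvd // (ltn_trans _ p40).
by rewrite /H q2 re_expFp_mul4.
Qed.

Theorem theorem1p2 (R : realType) :
  exists (c : R) (p0 : nat), 0 < c /\
    forall p : nat, prime p -> (p0 <= p)%N ->
      exists (n0 : nat) (A : forall n : nat, {set 'rV['F_p]_n}),
        [/\ (0 < n0)%N,
            (fun n : nat => density R (A n)) @ \oo --> (1 / 2 : R)
          & forall n : nat, (n0 <= n)%N ->
              forall d : 'rV['F_p]_n, d != 0 ->
                Num.min (I3 (ind R (A n)) d) (I3 (ind R (A n)) (d *+ 2))
                  <= 1 / 8 - c].
Proof.
(* Half of the saving in [few_progressions]. The other half absorbs [7/p]: [1/p] from that lemma and
   [6/p] from adding up to [2/p] in density, counted at three positions. *)
pose c : R := (9 / 64) / 36 ^+ 3.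
have c0 : 0 < c by rewrite divr_gt0 ?exprn_gt0.
exists c, (maxn 41 (Num.truncn (7 / c)).+1); split=> // p p_pr.
rewrite geq_max => /andP[p40 pc].
have p0 : 0 < p%:R :> R by rewrite ltr0n prime_gt0.
have pc7 : 7 / p%:R <= c.
  rewrite ler_pdivrMr // mulrC -ler_pdivrMr //.
  by apply: le_trans (ltW (truncnS_gt _)) _; rewrite ler_nat.
have [N hN] := few_progressions R p_pr p40.
have {}hN n : exists A : {set 'rV['F_p]_n}, (N <= n)%N ->
    #|A| = (p ^ n)./2 /\ forall d, d != 0 ->
    Num.min (I3 (ind R A) d) (I3 (ind R A) (d *+ 2)) <= 1 / 8 - c.
  (* Below [N] nothing is claimed, and the empty set serves as a default. *)
  have [Nn|nN] := leqP N n; last by exists (finset.set0).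
  have [A0 [cA0 hA0]] := hN n Nn.
  have [|A [cA dA]] := @resize_set _ A0 (p ^ n)./2.
    by rewrite card_mx card_Fp // mul1n leq_half_double -addnn; lia.
  exists A => _; split=> // d d0.
  have q0 : 0 < (p ^ n)%:R :> R by rewrite ltr0n expn_gt0 prime_gt0.
  (* Points are added only if [A0] is below half density, and then the lower bound on [A0] limits
     their number. *)
  have dAR : #|A :\: A0|%:R <= 2 / p%:R * (p ^ n)%:R :> R.
    have halfR : (p ^ n)./2%:R <= (p ^ n)%:R / 2 :> R.
      rewrite ler_pdivlMr // -natrM ler_nat muln2 -[leqRHS]odd_double_half; exact: leq_addl.
    have [le|lt] := leqP #|A0| (p ^ n)./2.
      apply: le_trans (_ : ((p ^ n)./2 - #|A0|)%:R <= _); first by rewrite ler_nat.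
      rewrite natrB //; move: cA0; rewrite mulrBl; lra.
    have /eqP-> : #|A :\: A0| == 0%N.
      by rewrite -leqn0 (leq_trans dA) // leqn0 subn_eq0 ltnW.
    by rewrite mulr_ge0 // divr_ge0 // ltW.
  have le e : I3 (ind R A) e <= I3 (ind R A0) e + 6 / p%:R.
    rewrite !I3_ind // ler_pdivrMr // mulrDl divfK ?gt_eqF //.
    have := card_progressions_le A A0 e; rewrite -(ler_nat R) natrD natrM => h.
    apply: (le_trans h); rewrite lerD2l; lra.
  have [h1 h2] := (le d, le (d *+ 2)).
  have : Num.min (I3 (ind R A) d) (I3 (ind R A) (d *+ 2)) <=
    Num.min (I3 (ind R A0) d) (I3 (ind R A0) (d *+ 2)) + 6 / p%:R.
    by rewrite addr_minl le_min !ge_min h1 h2 orbT.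
  have := hA0 d d0; rewrite (_ : 9 / 32 / 36 ^+ 3 = c + c); last by rewrite /c; field.
  move: pc7; rewrite -[7]/(1 + 6)%:R natrD mulrDl; lra.
exists (maxn 1 N), (fun n => sval (cid (hN n))).
have hA n := svalP (cid (hN n)); split.
- by rewrite leq_max.
- by apply: (@half_density_cvg _ _ N) => // n /(hA n)[].
- by move=> n; rewrite geq_max => /andP[_] /(hA n)[].
Qed.
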